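(* Let $\mathcal{U}=\{u_0,\dots,u_{18}\}$ be the Wang tile set and $\omega$ the 2-dimensional morphism $\omega:\Omega_{\mathcal{U}}\to\Omega_{\mathcal{U}}$ given in the context. Then $\omega$ is expansive, recognizable in $\Omega_{\mathcal{U}}$ and satisfies $$\Omega_{\mathcal{U}}=\omega(\Omega_{\mathcal{U}})\cup\sigma^{\mathbf e_1}\omega(\Omega_{\mathcal{U}})\cup\sigma^{\mathbf e_2}\omega(\Omega_{\mathcal{U}})\cup\sigma^{\mathbf e_1+\mathbf e_2}\omega(\Omega_{\mathcal{U}}).$$
   Context: A Wang tile is a 4-tuple $\tau=(a,b,c,d)$ of colors, $a=\mathrm{right}(\tau)$, $b=\mathrm{top}(\tau)$, $c=\mathrm{left}(\tau)$, $d=\mathrm{bottom}(\tau)$. For a finite set $\mathcal{T}$ of Wang tiles, the Wang shift $\Omega_{\mathcal{T}}$ is the set of all $x:\mathbb{Z}^2\to\mathcal{T}$ with $\mathrm{right}(x(\mathbf n))=\mathrm{left}(x(\mathbf n+\mathbf e_1))$ and $\mathrm{top}(x(\mathbf n))=\mathrm{bottom}(x(\mathbf n+\mathbf e_2))$ for all $\mathbf n\in\mathbb{Z}^2$, where $\mathbf e_1=(1,0)$, $\mathbf e_2=(0,1)$. The shift action is $(\sigma^{\mathbf n}x)_{\mathbf m}=x_{\mathbf m+\mathbf n}$. The tile set $\mathcal{U}$, written as (right, top, left, bottom): $u_0=(F,O,J,O)$, $u_1=(F,O,H,L)$, $u_2=(J,M,F,P)$, $u_3=(D,M,F,K)$,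 $u_4=(H,P,J,P)$, $u_5=(H,P,H,N)$, $u_6=(H,K,F,P)$, $u_7=(H,K,D,P)$, $u_8=(B,O,I,O)$, $u_9=(G,L,E,O)$, $u_{10}=(G,L,C,L)$, $u_{11}=(A,L,I,O)$, $u_{12}=(E,P,G,P)$, $u_{13}=(E,P,I,P)$, $u_{14}=(I,P,G,K)$, $u_{15}=(I,P,I,K)$, $u_{16}=(I,K,B,M)$, $u_{17}=(I,K,A,K)$, $u_{18}=(C,N,I,P)$. The morphism $\omega$ (matrices in Cartesian orientation: the first row is the top row): $u_0\mapsto(u_{17})$, $u_1\mapsto(u_{16})$, $u_2\mapsto(u_{15}\ u_{11})$, $u_3\mapsto(u_{13}\ u_9)$, $u_4\mapsto(u_{17}\ u_8)$, $u_5\mapsto(u_{16}\ u_8)$, $u_6\mapsto(u_{15}\ u_8)$, $u_7\mapsto(u_{14}\ u_8)$, $u_8\mapsto\begin{pmatrix}u_6\\ u_{14}\end{pmatrix}$, $u_9\mapsto\begin{pmatrix}u_3\\ u_{17}\end{pmatrix}$, $u_{10}\mapsto\begin{pmatrix}u_3\\ u_{16}\end{pmatrix}$, $u_{11}\mapsto\begin{pmatrix}u_2\\ u_{14}\end{pmatrix}$, $u_{12}\mapsto\begin{pmatrix}u_7&u_1\\ u_{15}&u_{11}\end{pmatrix}$, $u_{13}\mapsto\begin{pmatrix}u_6&u_1\\ u_{14}&u_{11}\end{pmatrix}$, $u_{14}\mapsto\begin{pmatrix}u_7&u_1\\ u_{13}&u_9\end{pmatrix}$, $u_{15}\mapsto\begin{pmatrix}u_6&u_1\\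 u_{12}&u_9\end{pmatrix}$, $u_{16}\mapsto\begin{pmatrix}u_5&u_1\\ u_{18}&u_{10}\end{pmatrix}$, $u_{17}\mapsto\begin{pmatrix}u_4&u_1\\ u_{13}&u_9\end{pmatrix}$, $u_{18}\mapsto\begin{pmatrix}u_2&u_0\\ u_{14}&u_8\end{pmatrix}$. A 2-dimensional word of shape $(n_1,n_2)\in\mathbb{N}^2$ over $\mathcal{A}$ is a map $\{0,\dots,n_1-1\}\times\{0,\dots,n_2-1\}\to\mathcal{A}$; $\mathcal{A}^{*^2}$ is the set of all of them. Two words can be concatenated in direction $\mathbf e_i$ if their shapes agree except possibly in coordinate $i$. A 2-dimensional morphism $\omega:X\to Y$ between $X\subseteq\mathcal{A}^{\mathbb{Z}^2}$ and $Y\subseteq\mathcal{B}^{\mathbb{Z}^2}$ is given by images $\omega(a)\in\mathcal{B}^{*^2}$ of letters such that for every $x\in X$ the images of any two letters of $x$ at positions $\mathbf n,\mathbf n+\mathbf e_i$ can be concatenated in direction $\mathbf e_i$; $\omega(x)\in Y$ is obtained by concatenating all the images, with the lower-left corner of $\omega(x_{\mathbf 0})$ at the origin. (Finite words occurring in elements of $X$ are mapped likewise by concatenation.) When $\mathcal{A}=\mathcal{B}$, $\omega$ is expansive if for every letter $a$ and $K\in\mathbb{N}$ there is $m$ with $\min(\mathrm{shape}(\omega^m(a)))>K$. Recognizability: for $y\in\mathcal{B}^{\mathbb{Z}^2}$, a pair $(\mathbf k,x)$ with $x\in X$, $\mathbf k\in\mathbb{Z}^2$ and $y=\sigma^{\mathbf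 k}\omega(x)$ is an $\omega$-representation of $y$; it is centered if $\mathbf 0\le\mathbf k<\mathrm{shape}(\omega(x_{\mathbf 0}))$ coordinate-wise. $\omega$ is recognizable in $X$ if each $y\in\mathcal{B}^{\mathbb{Z}^2}$ has at most one centered $\omega$-representation $(\mathbf k,x)$ with $x\in X$. *)

(* Defs.v *)
From HB Require Import structures.
From mathcomp Require Import all_boot all_order all_algebra.
From mathcomp Require Import boolp classical_sets.

Set Implicit Arguments.
Unset Strict Implicit.
Unset Printing Implicit Defensive.

Import Order.TTheory GRing.Theory Num.Theory.

Local Open Scope classical_set_scope.
Local Open Scope ring_scope.

Definition Z2 : Type := (int * int)%type.
Definition e1 : Z2 := (1, 0).
Definition e2 : Z2 := (0, 1).

Definition conf (A : Type) : Type := Z2 -> A.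

Definition shift (A : Type) (n : Z2) (x : conf A) : conf A :=
  fun m => x (m + n).

Record wang_tile (C : Type) : Type :=
  WangTile { right : C; top : C; left : C; bottom : C }.

(* A finite set of Wang tiles is given by a finite type T of labels together
   with an (injective) labelling tile : T -> wang_tile C. *)
Definition wang_shift (C : Type) (T : finType) (tile : T -> wang_tile C) :
    set (conf T) :=
  [set x | forall n : Z2,
      right (tile (x n)) = left (tile (x (n + e1))) /\
      top (tile (x n)) = bottom (tile (x (n + e2)))].

(* Cartesian convention: w i j is the letter in column i (from the left) and
   row j (from the bottom). *)
Record word2 (A : Type) : Type := Word2 {
  shape : nat * nat;
  letter_at :> 'I_shape.1 -> 'I_shape.2 -> A }.

Definition letter_word (A : Type) (a : A) : word2 A :=
  @Word2 A (1%N, 1%N) (fun _ _ => a).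

Definition concatenable1 (A : Type) (u v : word2 A) : Prop :=
  (shape u).2 = (shape v).2.
Definition concatenable2 (A : Type) (u v : word2 A) : Prop :=
  (shape u).1 = (shape v).1.

(* conf_image f x y : y = f(x). The block f(x_n) has its lower-left corner at
   (p n.1, q n.2); the existence of such common abscissas and ordinates forces
   horizontally (vertically) adjacent blocks to have equal heights (widths), and
   the last clause says that the blocks cover the plane and spell y.  This
   determines y (conf_image_uniq below). *)
Definition conf_image (A B : Type) (f : A -> word2 B)
    (x : conf A) (y : conf B) : Prop :=
  exists p q : int -> int,
    [/\ p 0 = 0 /\ q 0 = 0,
        forall n : Z2, p (n.1 + 1) = p n.1 + (shape (f (x n))).1%:Z,
        forall n : Z2, q (n.2 + 1) = q n.2 + (shape (f (x n))).2%:Z &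
        forall m : Z2, exists (n : Z2) (s : 'I_(shape (f (x n))).1)
                         (t : 'I_(shape (f (x n))).2),
          m = (p n.1 + s%:Z, q n.2 + t%:Z) /\ y m = f (x n) s t].

(* word_image f u v : v = f(u), by the same cutting of v into blocks. *)
Definition word_image (A B : Type) (f : A -> word2 B)
    (u : word2 A) (v : word2 B) : Prop :=
  exists p q : nat -> nat,
    [/\ p 0 = 0 /\ q 0 = 0,
        forall (i : 'I_(shape u).1) (j : 'I_(shape u).2),
          p i.+1 = (p i + (shape (f (u i j))).1)%N,
        forall (i : 'I_(shape u).1) (j : 'I_(shape u).2),
          q j.+1 = (q j + (shape (f (u i j))).2)%N,
        shape v = (p (shape u).1, q (shape u).2) &
        forall (k : 'I_(shape v).1) (l : 'I_(shape v).2),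
          exists (i : 'I_(shape u).1) (j : 'I_(shape u).2)
                 (s : 'I_(shape (f (u i j))).1)
                 (t : 'I_(shape (f (u i j))).2),
            [/\ k = p i + s :> nat, l = q j + t :> nat &
                v k l = f (u i j) s t]]%N.

Fixpoint iter_image (A : Type) (f : A -> word2 A) (m : nat)
    (u v : word2 A) : Prop :=
  if m is m'.+1 then
    exists w : word2 A, iter_image f m' u w /\ word_image f w v
  else v = u.

Definition is_morphism2 (A B : Type) (f : A -> word2 B)
    (X : set (conf A)) (Y : set (conf B)) : Prop :=
  (forall x, X x -> forall n,
     concatenable1 (f (x n)) (f (x (n + e1))) /\
     concatenable2 (f (x n)) (f (x (n + e2)))) /\
  (forall x, X x -> exists y, Y y /\ conf_image f x y).

Definition image_set (A B : Type) (f : A -> word2 B) (X : set (conf A)) :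
    set (conf B) :=
  [set y | exists x, X x /\ conf_image f x y].

Definition expansive (A : Type) (f : A -> word2 A) : Prop :=
  forall (a : A) (K : nat), exists (m : nat) (w : word2 A),
    iter_image f m (letter_word a) w /\ (K < minn (shape w).1 (shape w).2)%N.

Definition representation (A B : Type) (f : A -> word2 B) (X : set (conf A))
    (y : conf B) (k : Z2) (x : conf A) : Prop :=
  X x /\ exists z, conf_image f x z /\ y = shift k z.

Definition centered (A B : Type) (f : A -> word2 B) (k : Z2) (x : conf A) :
    Prop :=
  (0 <= k.1 < (shape (f (x 0))).1%:Z) /\ (0 <= k.2 < (shape (f (x 0))).2%:Z).

Definition recognizable (A B : Type) (f : A -> word2 B) (X : set (conf A)) :
    Prop :=
  forall y : conf B,
    is_subset1 [set kx : Z2 * conf A |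
      representation f X y kx.1 kx.2 /\ centered f kx.1 kx.2].

Section ConfImageUniq.
Variables (A B : Type) (f : A -> word2 B) (x : conf A).

Let offset_uniq (p p' w : int -> int) : p 0 = 0 -> p' 0 = 0 ->
  (forall i, p (i + 1) = p i + w i) -> (forall i, p' (i + 1) = p' i + w i) ->
  p =1 p'.
Proof.
move=> p0 p'0 pS p'S; elim/int_ind => [|n IH|n IH]; first by rewrite p0 p'0.
- by rewrite -addn1 PoszD pS p'S IH.
- apply: (addIr (w (- n.+1%:Z))); rewrite -pS -p'S.
  by rewrite -addn1 PoszD opprD subrK.
Qed.

Let offset_mono (p : int -> int) (w : int -> nat) :
  (forall i, p (i + 1) = p i + (w i)%:Z) ->
  forall i j, i < j -> p i + (w i)%:Z <= p j.
Proof.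
move=> pS i j; rewrite -lezD1 -pS => le_ij.
have -> : j = i + 1 + `|(j - (i + 1))%R|%N%:Z.
  by rewrite gez0_abs ?subr_ge0// addrC subrK.
elim: `|_|%N => [|n IH]; first by rewrite addr0.
by rewrite -addn1 PoszD [i + 1 + _]addrA (pS (i + 1 + n%:Z)) (le_trans IH)// lerDl.
Qed.

Let offset_block (p : int -> int) (w : int -> nat) i j (s t : nat) :
  (forall i, p (i + 1) = p i + (w i)%:Z) ->
  (s < w i)%N -> (t < w j)%N -> p i + s%:Z = p j + t%:Z -> i = j.
Proof.
move=> pS; wlog lt_ij : i j s t / i < j => [W si tj E|si _ E].
  by case: (ltgtP i j) => // h; [apply: (W i j s t)|apply/esym/(W j i t s)].
have := offset_mono pS lt_ij; rewrite leNgt => /negP[].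
by rewrite (le_lt_trans (y := p i + s%:Z)) ?ltrD2l// E lerDl.
Qed.

Lemma conf_image_uniq (y y' : conf B) :
  conf_image f x y -> conf_image f x y' -> y = y'.
Proof.
move=> [p [q [[p0 q0] pS qS yE]]] [p' [q' [[p'0 q'0] p'S q'S y'E]]].
pose w i := (shape (f (x (i, 0)))).1; pose h j := (shape (f (x (0, j)))).2.
have wE n : (shape (f (x n))).1 = w n.1.
  by have := pS n; rewrite (pS (n.1, 0)) => /addrI[].
have hE n : (shape (f (x n))).2 = h n.2.
  by have := qS n; rewrite (qS (0, n.2)) => /addrI[].
have pw i : p (i + 1) = p i + (w i)%:Z := pS (i, 0).
have qh j : q (j + 1) = q j + (h j)%:Z := qS (0, j).
have pp' := offset_uniq p'0 p0 (fun i => p'S (i, 0)) pw.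
have qq' := offset_uniq q'0 q0 (fun j => q'S (0, j)) qh.
apply/funext => m.
have [n [s [t [mE ->]]]] := yE m; have [n' [s' [t' [mE' ->]]]] := y'E m.
move: mE'; rewrite mE pp' qq' => -[E1 E2].
have En : n = n'.
  apply/eqP; rewrite -pair_eqE; apply/andP; split; apply/eqP.
    by apply: offset_block pw _ _ E1; rewrite -wE.
  by apply: offset_block qh _ _ E2; rewrite -hE.
case: _ / En in s' t' E1 E2 *.
by congr (f (x n) _ _); apply/val_inj; [move/addrI: E1 => []|move/addrI: E2 => []].
Qed.

End ConfImageUniq.

Inductive color : Type :=
  cA | cB | cC | cD | cE | cF | cG | cH | cI | cJ | cK | cL | cM | cN | cO | cP.

Inductive U : Type :=
  u0 | u1 | u2 | u3 | u4 | u5 | u6 | u7 | u8 | u9 | u10 | u11 | u12 | u13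
| u14 | u15 | u16 | u17 | u18.

Definition U_enum : seq U :=
  [:: u0; u1; u2; u3; u4; u5; u6; u7; u8; u9; u10; u11; u12; u13; u14; u15;
      u16; u17; u18].

Definition U_index (a : U) : 'I_19 :=
  inord match a with
  | u0 => 0 | u1 => 1 | u2 => 2 | u3 => 3 | u4 => 4 | u5 => 5 | u6 => 6
  | u7 => 7 | u8 => 8 | u9 => 9 | u10 => 10 | u11 => 11 | u12 => 12
  | u13 => 13 | u14 => 14 | u15 => 15 | u16 => 16 | u17 => 17 | u18 => 18
  end.

Lemma U_indexK : cancel U_index (fun i => nth u0 U_enum i).
Proof. by case; rewrite /U_index /= inordK. Qed.

HB.instance Definition _ := Finite.copy U (can_type U_indexK).

Definition U_tile (a : U) : wang_tile color :=
  match a with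
  | u0 => WangTile cF cO cJ cO
  | u1 => WangTile cF cO cH cL
  | u2 => WangTile cJ cM cF cP
  | u3 => WangTile cD cM cF cK
  | u4 => WangTile cH cP cJ cP
  | u5 => WangTile cH cP cH cN
  | u6 => WangTile cH cK cF cP
  | u7 => WangTile cH cK cD cP
  | u8 => WangTile cB cO cI cO
  | u9 => WangTile cG cL cE cO
  | u10 => WangTile cG cL cC cL
  | u11 => WangTile cA cL cI cO
  | u12 => WangTile cE cP cG cP
  | u13 => WangTile cE cP cI cP
  | u14 => WangTile cI cP cG cK
  | u15 => WangTile cI cP cI cK
  | u16 => WangTile cI cK cB cM
  | u17 => WangTile cI cK cA cK
  | u18 => WangTile cC cN cI cP
  end.

Lemma U_tile_inj : injective U_tile.
Proof. by do 2!case. Qed.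

Definition Omega_U : set (conf U) := wang_shift U_tile.

(* The rows are listed from top to bottom, as in a displayed matrix. *)
Definition word_of_rows (s : seq (seq U)) : word2 U :=
  @Word2 U (size (head [::] s), size s)
    (fun i j => nth u0 (nth [::] (rev s) j) i).

Definition omega (a : U) : word2 U :=
  word_of_rows match a with
  | u0 => [:: [:: u17]]
  | u1 => [:: [:: u16]]
  | u2 => [:: [:: u15; u11]]
  | u3 => [:: [:: u13; u9]]
  | u4 => [:: [:: u17; u8]]
  | u5 => [:: [:: u16; u8]]
  | u6 => [:: [:: u15; u8]]
  | u7 => [:: [:: u14; u8]]
  | u8 => [:: [:: u6]; [:: u14]]
  | u9 => [:: [:: u3]; [:: u17]]
  | u10 => [:: [:: u3]; [:: u16]]
  | u11 => [:: [:: u2]; [:: u14]]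
  | u12 => [:: [:: u7; u1]; [:: u15; u11]]
  | u13 => [:: [:: u6; u1]; [:: u14; u11]]
  | u14 => [:: [:: u7; u1]; [:: u13; u9]]
  | u15 => [:: [:: u6; u1]; [:: u12; u9]]
  | u16 => [:: [:: u5; u1]; [:: u18; u10]]
  | u17 => [:: [:: u4; u1]; [:: u13; u9]]
  | u18 => [:: [:: u2; u0]; [:: u14; u8]]
  end.

(* Main.v *)
Require Import Defs.
From mathcomp Require Import all_boot all_order all_algebra.
From mathcomp Require Import boolp classical_sets.
Import GRing.Theory.
Import Order.TTheory Num.Theory.
Local Open Scope classical_set_scope.
Local Open Scope ring_scope.

(** Call a tile thin when its image under [omega] has one column and flat when
its image has one row.  Both properties can be read on colours: thin tiles have
their top and bottom colours in {L, O}, flat tiles have their left and right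
colours in {D, F, H, J}.  Hence in a point of the Wang shift thinness is constant
on columns and flatness is constant on rows, which is why the images of
neighbouring letters always fit together.  Conversely the second column of an
image is made of thin tiles and the first one is not, and likewise the second
row is made of flat tiles and the first one is not.  So the columns of thin
tiles and the rows of flat tiles of an image [omega(x)] show where the blocks
are cut.  As [omega] is injective on letters, the cutting determines [x]
([image_inj]), and the position of the origin in its block is determined too
([centered_offset]): this is recognizability.

For the covering of the Wang shift, let [z] be one of its points.  Two thin
columns, or two flat rows, are never adjacent: the first is immediate from the
colours, the second is found by listing all patterns of size 5 x 2.  So [z] can
be cut into blocks, each starting with a tile neither thin nor flat and extended
by the thin column on its right and the flat row above it, if there are any.
Listing all patterns of size 4 x 3 shows that each block is the image of a letter
([block_exists]).  Finally the colours on a side of the image of a letter encode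
the colour of the letter on that side injectively ([hmatch_blocks],
[vmatch_blocks]).  Therefore the letters read in this way form a point of the
Wang shift ([desubstitution]), and conversely images of points of the Wang shift
belong to it ([image_Omega]).  The four translates in the covering correspond
to the four possible positions of the origin in its block.

Expansivity does not involve the Wang rules: it is enough to know which columns
are thin and which rows are flat.  An image starts with a column that is not thin
and a row that is not flat, so from the second iteration on each dimension grows
by at least one at each step ([image_gridded]). *)

Set Implicit Arguments.
Unset Strict Implicit.
Unset Printing Implicit Defensive.

Local Notation shape := Defs.shape.

(** * Functions of an integer *)

Lemma PoszS n : n.+1%:Z = n%:Z + 1.
Proof. by rewrite -addn1 PoszD. Qed.

Lemma addPoszI (a : int) m n : a + m%:Z = a + n%:Z -> m = n.
Proof. by move=> /addrI[]. Qed.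

Lemma step_invariant_const (T : Type) (f : int -> T) :
  (forall i, f (i + 1) = f i) -> forall i, f i = f 0.
Proof.
move=> fS; elim/int_ind => // n IH; first by rewrite PoszS fS.
by rewrite -IH -fS PoszS opprD subrK.
Qed.

(** * Letters and their images *)

(* These equalities reduce by computation, which the exhaustive searches need. *)
Scheme Boolean Equality for color.
Scheme Boolean Equality for U.

Lemma color_beqP c d : reflect (c = d) (color_beq c d).
Proof. by apply: (iffP idP) => [|->]; [case: c; case: d | case: d]. Qed.

Lemma U_beqP a b : reflect (a = b) (U_beq a b).
Proof. by apply: (iffP idP) => [|->]; [case: a; case: b | case: b]. Qed.

Definition thin (a : U) : bool :=
  if top (U_tile a) is (cO | cL) then true else false.
Definition flat (a : U) : bool :=
  if right (U_tile a) is (cD | cF | cH | cJ) then true else false.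
Definition width (a : U) : nat := (~~ thin a).+1.
Definition height (a : U) : nat := (~~ flat a).+1.

Lemma widthE a : (shape (omega a)).1 = width a. Proof. by case: a. Qed.
Lemma heightE a : (shape (omega a)).2 = height a. Proof. by case: a. Qed.

(** [omega a] as a total function of natural numbers, which avoids dependent
indices and still computes. *)
Definition letter (a : U) (s t : nat) : U :=
  if insub_eq _ s is Some i then
    if insub_eq _ t is Some j then omega a i j else u0 else u0.

Lemma letterE a (i : 'I_(shape (omega a)).1) (j : 'I_(shape (omega a)).2) :
  omega a i j = letter a i j.
Proof. by rewrite /letter !insub_eqE !valK. Qed.

(** Thinness and flatness mark the second column and the second row of images:
this is what makes the cutting into blocks visible. *)
Lemma thin_letter a s t : (s < width a)%N -> (t < height a)%N ->
  thin (letter a s t) = (s == 1%N).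
Proof. by case: a; case: s => [|[|s]] //; case: t => [|[|t]]. Qed.

Lemma flat_letter a s t : (s < width a)%N -> (t < height a)%N ->
  flat (letter a s t) = (t == 1%N).
Proof. by case: a; case: s => [|[|s]] //; case: t => [|[|t]]. Qed.

Lemma letter_inj a b : thin a = thin b -> flat a = flat b ->
  (forall s t, (s < width a)%N -> (t < height a)%N ->
     letter a s t = letter b s t) -> a = b.
Proof.
move=> + + E; move: (E 0%N 0%N) (E 1%N 0%N) (E 0%N 1%N).
by case: a {E}; case: b => // E F G _ _;
  first [have := E isT isT; discriminate | have := F isT isT; discriminate
       | have := G isT isT; discriminate].
Qed.

Definition hmatch (a b : U) : bool :=
  color_beq (right (U_tile a)) (left (U_tile b)).
Definition vmatch (a b : U) : bool :=
  color_beq (top (U_tile a)) (bottom (U_tile b)).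

Lemma Omega_UP (x : conf U) :
  Omega_U x <-> forall n, hmatch (x n) (x (n + e1)) /\ vmatch (x n) (x (n + e2)).
Proof.
by split=> X n; have [/color_beqP h /color_beqP v] := X n.
Qed.

Lemma hmatch_flat a b : hmatch a b -> flat a = flat b.
Proof. by case: a; case: b. Qed.

Lemma vmatch_thin a b : vmatch a b -> thin a = thin b.
Proof. by case: a; case: b. Qed.

Lemma hmatch_no_thin_pair a b : hmatch a b -> ~~ (thin a && thin b).
Proof. by case: a; case: b. Qed.

Lemma hmatch_letter a s t : (s.+1 < width a)%N -> (t < height a)%N ->
  hmatch (letter a s t) (letter a s.+1 t).
Proof. by case: a; case: s => [|[|s]] //; case: t => [|[|t]]. Qed.

Lemma vmatch_letter a s t : (s < width a)%N -> (t.+1 < height a)%N ->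
  vmatch (letter a s t) (letter a s t.+1).
Proof. by case: a; case: s => [|[|s]] //; case: t => [|[|t]]. Qed.

(** A side of the image of [a] spells a word of one or two colours which
determines, and is determined by, the colour of [a] on that side.  So two letters
may be juxtaposed exactly when their images may.  The boolean [~~ thin a],
read as a number, is the index of the last column of the image. *)
Lemma hmatch_blocks a b : flat a = flat b ->
  hmatch a b =
  all (fun t => hmatch (letter a (~~ thin a) t) (letter b 0 t))
      (iota 0 (height a)).
Proof. by case: a; case: b. Qed.

Lemma vmatch_blocks a b : thin a = thin b ->
  vmatch a b =
  all (fun s => vmatch (letter a s (~~ flat a)) (letter b s 0))
      (iota 0 (width a)).
Proof. by case: a; case: b. Qed.

(** * Exhaustive search in small windows *)

Definition extend (ws : seq (seq U)) : seq (seq U) :=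
  [seq a :: r | a <- U_enum,
                r <- [seq r <- ws | if r is b :: _ then hmatch a b else true]].

Definition row_words (n : nat) : seq (seq U) := iter n extend [:: [::]].

Definition row_at (x : conf U) (m : Z2) (n : nat) : seq U :=
  mkseq (fun i => x (m + (i%:Z, 0))) n.

Lemma mem_U_enum a : a \in U_enum.
Proof. by rewrite -(U_indexK a) mem_nth. Qed.

Lemma mem_row_words x m n : Omega_U x -> row_at x m n \in row_words n.
Proof.
move=> X; elim: n m => [//|n IH] m.
have -> : row_at x m n.+1 = x m :: row_at x (m + e1) n.
  rewrite /row_at /mkseq /= addr0 -[1%N]addn0 iotaDl -map_comp; congr cons.
  by apply: eq_map => i /=; rewrite -addrA; congr (x (_ + (_, _))).
apply/allpairsPdep; exists (x m), (row_at x (m + e1) n).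
rewrite mem_U_enum mem_filter IH andbT; split=> //.
case: n {IH} => // n; rewrite /row_at /= addr0.
by have /Omega_UP/(_ m)[] := X.
Qed.

Lemma row_above x m n : Omega_U x ->
  all2 vmatch (row_at x m n) (row_at x (m + e2) n).
Proof.
move=> /Omega_UP X; rewrite /row_at /mkseq; elim: (iota 0 n) => //= i s ->.
by rewrite andbT addrAC; have [] := X (m + (i%:Z, 0)).
Qed.

Definition above (ws : seq (seq U)) (r : seq U) : seq (seq U) :=
  [seq s <- ws | all2 vmatch r s].

Lemma mem_above x m n : Omega_U x ->
  row_at x (m + e2) n \in above (row_words n) (row_at x m n).
Proof. by move=> X; rewrite mem_filter mem_row_words// row_above. Qed.

(** Flatness is constant along rows, so testing the first tiles is enough. *)
Definition no_flat_pair (ws : seq (seq U)) : bool :=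
  all (fun r => all (fun s => ~~ (flat (head u0 r) && flat (head u0 s)))
                    (above ws r)) ws.

Lemma no_flat_pairP ws r s : no_flat_pair ws -> r \in ws -> s \in above ws r ->
  ~~ (flat (head u0 r) && flat (head u0 s)).
Proof. by move=> /allP W /W/allP W1 /W1. Qed.

(** Width 5 is the least one for which this holds with two rows: pairs of flat
rows do occur in narrower patterns. *)
Lemma no_flat_pairT : no_flat_pair (row_words 5).
Proof. vm_compute; reflexivity. Qed.

(** [cell s t] stands for the tile at offset [(s, t)] from the lower left corner
of a block. *)
Definition spells (cell : nat -> nat -> U) (a : U) : bool :=
  [&& eqb (thin a) (~~ thin (cell 1 0)), eqb (flat a) (~~ flat (cell 0 1)) &
      all (fun s => all (fun t => U_beq (cell s t) (letter a s t))
                        (iota 0 (height a))) (iota 0 (width a))]%N.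

(** The block starts at column 1 of the middle row [r1].  It extends at most to
column 2 and to row [r2]; the remaining columns and the row [r0] are the context
that excludes the blocks that are not images. *)
Definition blocks_spelled (ws : seq (seq U)) : bool :=
  all (fun r0 => all (fun r1 => thin (nth u0 r1 1) || flat (nth u0 r1 1) ||
    all (fun r2 =>
      has (spells (fun s t => nth u0 (nth [::] [:: r1; r2] t) s.+1)) U_enum)
    (above ws r1)) (above ws r0)) ws.

Lemma blocks_spelledP ws r0 r1 r2 : blocks_spelled ws ->
  r0 \in ws -> r1 \in above ws r0 -> r2 \in above ws r1 ->
  thin (nth u0 r1 1) = false -> flat (nth u0 r1 1) = false ->
  exists a, spells (fun s t => nth u0 (nth [::] [:: r1; r2] t) s.+1) a.
Proof.
move=> /allP W /W/allP W1 /W1 + + t f; rewrite t f => /allP W2 /W2/hasP[a _].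
by exists a.
Qed.

Lemma blocks_spelledT : blocks_spelled (row_words 4).
Proof. vm_compute; reflexivity. Qed.

(** * Local structure of the points of the Wang shift *)

Lemma row_at_nth x m n i : (i < n)%N -> nth u0 (row_at x m n) i = x (m + (i%:Z, 0)).
Proof. exact: nth_mkseq. Qed.

Lemma no_flat_pair_column x m : Omega_U x -> ~~ (flat (x m) && flat (x (m + e2))).
Proof.
move=> X; have := no_flat_pairP no_flat_pairT (mem_row_words m 5 X) (mem_above m 5 X).
by rewrite /row_at /= !addr0.
Qed.

(** The block starting at [m] has a second column exactly when the next column is
thin, and a second row exactly when the next row is flat. *)
Lemma block_exists x m : Omega_U x -> thin (x m) = false -> flat (x m) = false ->
  exists a, [/\ thin a = ~~ thin (x (m + e1)), flat a = ~~ flat (x (m + e2)) &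
    forall s t, (s < width a)%N -> (t < height a)%N ->
      x (m + (s%:Z, t%:Z)) = letter a s t].
Proof.
move=> X m1 m2.
(* [c] is the lower left corner of the window, so that [m] is its cell (1, 1). *)
pose c : Z2 := m - e1 - e2.
have cE s t : c + e2 + (s.+1%:Z, 0) + (0, t%:Z) = m + (s%:Z, t%:Z).
  rewrite /c subrK -addrA -[m - e1 + _]addrA; congr (_ + _).
  by congr (_, _); rewrite /= ?add0r ?addr0 // PoszS addrC addrK.
have := blocks_spelledP blocks_spelledT (mem_row_words c 4 X) (mem_above c 4 X)
  (mem_above (c + e2) 4 X).
have nE s t : (s < 3)%N -> (t < 2)%N ->
    nth u0 (nth [::] [:: row_at x (c + e2) 4; row_at x (c + e2 + e2) 4] t) s.+1
    = x (m + (s%:Z, t%:Z)).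
  move=> s3; case: t => [|[|t]] // _; rewrite -cE [nth [::] _ _]/= row_at_nth //.
    by rewrite addr0.
  by rewrite addrAC.
have := nE 0%N 0%N isT isT; rewrite addr0 => ->; move=> /(_ m1 m2)[a /and3P[]].
rewrite !nE // => /eqP a1 /eqP a2 /allP aE; exists a; split=> // s t sa ta.
have /aE/allP/(_ t) : s \in iota 0 (width a) by rewrite mem_iota.
rewrite mem_iota ta nE // => [/(_ isT)/U_beqP //||].
  by rewrite (leq_trans sa)// /width; case: (thin a).
by rewrite (leq_trans ta)// /height; case: (flat a).
Qed.

Lemma Omega_shift k x : Omega_U x -> Omega_U (shift k x).
Proof. by move=> X n; rewrite /shift ![n + _ + k]addrAC; exact: X. Qed.

Lemma thin_column x : Omega_U x -> forall n, thin (x n) = thin (x (n.1, 0)).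
Proof.
move=> /Omega_UP X [i j].
apply: (@step_invariant_const _ (fun j => thin (x (i, j)))) => {}j.
by have [_ /vmatch_thin ->] := X (i, j); rewrite -[(i, j) + e2]/(i + 0, j + 1) addr0.
Qed.

Lemma flat_row x : Omega_U x -> forall n, flat (x n) = flat (x (0, n.2)).
Proof.
move=> /Omega_UP X [i j].
apply: (@step_invariant_const _ (fun i => flat (x (i, j)))) => {}i.
by have [/hmatch_flat -> _] := X (i, j); rewrite -[(i, j) + e1]/(i + 1, j + 0) addr0.
Qed.

(** * Cuttings of the line into intervals *)

(** [p i] is the left end of the interval number [i], of length [w i]. *)
Definition offsets (w : int -> nat) (p : int -> int) : Prop :=
  p 0 = 0 /\ forall i, p (i + 1) = p i + (w i)%:Z.

Lemma offsets_exist w : exists p, offsets w p.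
Proof.
exists (fun i => match i with
  | Posz n => (\sum_(k < n) w k)%N%:Z
  | Negz n => - (\sum_(k < n.+1) w (- k.+1%:Z))%N%:Z end).
split=> [|[n|[|n]]].
- by rewrite -[LHS]/(Posz (\sum_(k < 0) w k)) big_ord0.
- by rewrite -PoszS big_ord_recr PoszD.
- by rewrite -[LHS]/(Posz (\sum_(k < 0) w k)) big_ord0 big_ord_recr /= big_ord0 addNr.
rewrite (_ : Negz n.+1 + 1 = Negz n); last by rewrite NegzE PoszS opprD subrK.
by rewrite [in RHS]big_ord_recr PoszD opprD subrK.
Qed.

Lemma offsets_cover w p : offsets w p -> (forall i, 0 < w i)%N ->
  forall m, exists i s, (s < w i)%N /\ m = p i + s%:Z.
Proof.
move=> [p0 pS] w0; elim/int_ind => [|n [i [s [si E]]]|n [i [s [si E]]]].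
- by exists 0, 0%N; rewrite p0.
- have [si'|] := ltnP s.+1 (w i).
    by exists i, s.+1; rewrite PoszS E -addrA -PoszS.
  move=> si'; exists (i + 1), 0%N; rewrite w0 pS addr0 PoszS E -addrA.
  by rewrite -PoszS; split=> //; do 2!f_equal; apply/eqP; rewrite eqn_leq si.
have nE : - n.+1%:Z = p i + s%:Z - 1 by rewrite -E PoszS opprD.
case: s si nE {E} => [|s] si nE.
  exists (i - 1), (w (i - 1)).-1; rewrite prednK ?w0// nE addr0; split=> //.
  rewrite -{1}(subrK 1 i) pS -addrA; congr (_ + _).
  by rewrite -{1}(prednK (w0 (i - 1))) PoszS addrK.
by exists i, s; rewrite (ltnW si) nE PoszS addrA addrK.
Qed.

Lemma offsets_mono w p i j : offsets w p -> (i < j)%R -> (p i + (w i)%:Z <= p j)%R.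
Proof.
move=> [_ pS] ij; rewrite -pS -[j](subrK (i + 1)) [_ + (i + 1)]addrC.
have : (0 <= j - (i + 1))%R by rewrite subr_ge0 lezD1.
case: (j - (i + 1)) => // n _; elim: n => [|n IH]; first by rewrite [_ + Posz 0]addr0.
by rewrite PoszS addrA (pS (i + 1 + n%:Z)) (le_trans IH)// lerDl.
Qed.

Lemma offsets_inj w p i j s t : offsets w p -> (s < w i)%N -> (t < w j)%N ->
  p i + s%:Z = p j + t%:Z -> i = j /\ s = t.
Proof.
move=> pw; wlog lt_ij : i j s t / (i <= j)%R => [W si tj E|si tj E].
  have [ij|/ltW ij] := leP i j; first exact: W.
  by have [] := W j i t s ij tj si (esym E).
move: lt_ij; rewrite le_eqVlt => /predU1P[ij|ij].
  by move: E; rewrite ij => /addPoszI ->.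
have := offsets_mono pw ij; rewrite leNgt => /negP[].
by rewrite (le_lt_trans (y := p i + s%:Z)) ?ltrD2l// E lerDl.
Qed.

(** * Images of points of the Wang shift *)

(** Reading blocks from their positions is more convenient than locating each
position in a block; the two agree because the intervals of a cutting are
disjoint and cover the line. *)
Lemma omega_imageP x z : conf_image omega x z <->
  exists p q : int -> int, [/\ p 0 = 0 /\ q 0 = 0,
    forall n : Z2, p (n.1 + 1) = p n.1 + (width (x n))%:Z,
    forall n : Z2, q (n.2 + 1) = q n.2 + (height (x n))%:Z &
    forall (n : Z2) s t, (s < width (x n))%N -> (t < height (x n))%N ->
      z (p n.1 + s%:Z, q n.2 + t%:Z) = letter (x n) s t].
Proof.
split=> -[p [q [[p0 q0] pS qS zE]]]; exists p, q; split=> // n.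
- by rewrite pS widthE.
- by rewrite qS heightE.
- have pw : offsets (fun i => width (x (i, 0))) p.
    by split=> // i; rewrite (pS (i, 0)) widthE.
  have qw : offsets (fun j => height (x (0, j))) q.
    by split=> // j; rewrite (qS (0, j)) heightE.
  have wE k : width (x k) = width (x (k.1, 0)).
    by have := pS k; rewrite (pS (k.1, 0)) !widthE => /addPoszI ->.
  have hE k : height (x k) = height (x (0, k.2)).
    by have := qS k; rewrite (qS (0, k.2)) !heightE => /addPoszI ->.
  move=> s t sn tn; have [k [i [j [[E1 E2] ->]]]] := zE (p n.1 + s%:Z, q n.2 + t%:Z).
  rewrite letterE.
  have ik := ltn_ord i; rewrite {2}widthE wE in ik.
  have jk := ltn_ord j; rewrite {2}heightE hE in jk.
  rewrite wE in sn; rewrite hE in tn.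
  have [k1 ->] := offsets_inj pw sn ik E1; have [k2 ->] := offsets_inj qw tn jk E2.
  by congr (letter (x _)); rewrite [k]surjective_pairing [n]surjective_pairing k1 k2.
- by rewrite pS widthE.
- by rewrite qS heightE.
- have pw : offsets (fun i => width (x (i, 0))) p by split=> // i; rewrite (pS (i, 0)).
  have qw : offsets (fun j => height (x (0, j))) q by split=> // j; rewrite (qS (0, j)).
  have [i [s [si E1]]] := offsets_cover pw (fun _ => isT) n.1.
  have [j [t [tj E2]]] := offsets_cover qw (fun _ => isT) n.2.
  have sx : (s < (shape (omega (x (i, j)))).1)%N.
    by rewrite widthE; have := pS (i, j); rewrite (pS (i, 0)) => /addPoszI <-.
  have tx : (t < (shape (omega (x (i, j)))).2)%N.
    by rewrite heightE; have := qS (i, j); rewrite (qS (0, j)) => /addPoszI <-.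
  exists (i, j), (Ordinal sx), (Ordinal tx); rewrite letterE /=.
  rewrite [n]surjective_pairing E1 E2; split=> //; apply: (zE (i, j)).
    by rewrite -widthE.
  by rewrite -heightE.
Qed.

(** Two neighbouring tiles of the image are either in the same block, and match
by inspection of [omega], or on the common side of two blocks, and match
because the corresponding letters do. *)
Lemma image_Omega x z : Omega_U x -> conf_image omega x z -> Omega_U z.
Proof.
move=> X /omega_imageP[p [q [[p0 q0] pS qS zE]]]; apply/Omega_UP => m.
have pw : offsets (fun i => width (x (i, 0))) p by split=> // i; rewrite (pS (i, 0)).
have qw : offsets (fun j => height (x (0, j))) q by split=> // j; rewrite (qS (0, j)).
have [i [s [si E1]]] := offsets_cover pw (fun _ => isT) m.1.
have [j [t [tj E2]]] := offsets_cover qw (fun _ => isT) m.2.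
have {}si : (s < width (x (i, j)))%N by rewrite /width thin_column.
have {}tj : (t < height (x (i, j)))%N by rewrite /height flat_row.
have mE : m = (p i + s%:Z, q j + t%:Z) by rewrite -E1 -E2 -surjective_pairing.
rewrite mE (zE (i, j)) //; move/Omega_UP: (X) => /(_ (i, j)) [H V].
split.
  have [si'|si'] := ltnP s.+1 (width (x (i, j))).
    have -> : (p i + s%:Z, q j + t%:Z) + e1 = (p i + s.+1%:Z, q j + t%:Z).
      by congr (_, _); rewrite /= ?addr0// -addrA -PoszS.
    by rewrite (zE (i, j)) // hmatch_letter.
  have -> : (p i + s%:Z, q j + t%:Z) + e1 = (p (i + 1) + 0%:Z, q j + t%:Z).
    congr (_, _); rewrite /= ?addr0// -addrA -PoszS (pS (i, j)).
    by do 2!f_equal; apply/eqP; rewrite eqn_leq si.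
  have fE := hmatch_flat H; rewrite /e1 /= in fE H *.
  rewrite -[(i, j) + (1, 0)]/(i + 1, j + 0) addr0 in fE H.
  rewrite (zE (i + 1, j)) //; last by rewrite /height -fE.
  move: H; rewrite hmatch_blocks // => /allP/(_ t); rewrite mem_iota tj => /(_ isT).
  rewrite (_ : s = ~~ thin (x (i, j)))//.
  by apply/eqP; rewrite eqn_leq; apply/andP; split.
have [tj'|tj'] := ltnP t.+1 (height (x (i, j))).
  have -> : (p i + s%:Z, q j + t%:Z) + e2 = (p i + s%:Z, q j + t.+1%:Z).
    by congr (_, _); rewrite /= ?addr0// -addrA -PoszS.
  by rewrite (zE (i, j)) // vmatch_letter.
have -> : (p i + s%:Z, q j + t%:Z) + e2 = (p i + s%:Z, q (j + 1) + 0%:Z).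
  congr (_, _); rewrite /= ?addr0// -addrA -PoszS (qS (i, j)).
  by do 2!f_equal; apply/eqP; rewrite eqn_leq tj.
have fE := vmatch_thin V; rewrite /e2 /= in fE V *.
rewrite -[(i, j) + (0, 1)]/(i + 0, j + 1) addr0 in fE V.
rewrite (zE (i, j + 1)) //; last by rewrite /width -fE.
move: V; rewrite vmatch_blocks // => /allP/(_ s); rewrite mem_iota si => /(_ isT).
rewrite (_ : t = ~~ flat (x (i, j)))//.
by apply/eqP; rewrite eqn_leq; apply/andP; split.
Qed.

Lemma image_exists x : Omega_U x -> exists z, conf_image omega x z.
Proof.
move=> X.
have [p pw] := offsets_exist (fun i => width (x (i, 0))).
have [q qw] := offsets_exist (fun j => height (x (0, j))).
have wE n : width (x n) = width (x (n.1, 0)) by rewrite /width thin_column.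
have hE n : height (x n) = height (x (0, n.2)) by rewrite /height flat_row.
have /choice[z zP] (m : Z2) : exists b, exists (n : Z2) s t,
    [/\ (s < width (x n))%N, (t < height (x n))%N,
        m = (p n.1 + s%:Z, q n.2 + t%:Z) & b = letter (x n) s t].
  have [i [s [si E1]]] := offsets_cover pw (fun _ => isT) m.1.
  have [j [t [tj E2]]] := offsets_cover qw (fun _ => isT) m.2.
  exists (letter (x (i, j)) s t), (i, j), s, t.
  by rewrite wE hE [m]surjective_pairing E1 E2.
exists z; apply/omega_imageP; exists p, q; split=> //.
- by rewrite pw.1 qw.1.
- by move=> n; rewrite pw.2 [in RHS]wE.
- by move=> n; rewrite qw.2 [in RHS]hE.
move=> n s t sn tn.
have [k [s' [t' [sk tk [E1 E2] ->]]]] := zP (p n.1 + s%:Z, q n.2 + t%:Z).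
rewrite wE in sn; rewrite wE in sk; rewrite hE in tn; rewrite hE in tk.
have [k1 ->] := offsets_inj pw sn sk E1; have [k2 ->] := offsets_inj qw tn tk E2.
by congr (letter (x _)); rewrite [k]surjective_pairing [n]surjective_pairing k1 k2.
Qed.

(** * Reading the blocks of a configuration *)

(** The case of intervals of length one or two, where [S] marks the second point
of each interval of length two.  The cutting is then a function of [S]. *)
Definition cuts (S : int -> bool) (p : int -> int) : Prop :=
  [/\ p 0 = 0, forall i, S (p i) = false &
      forall i, p (i + 1) = p i + (S (p i + 1)).+1%:Z].

(** The recurrence on [p] can be run backwards: the interval ending at
[p (i + 1) - 1] has length two exactly when this point is marked. *)
Lemma cuts_uniq S p p' : cuts S p -> cuts S p' -> p =1 p'.
Proof.
have two : true.+1%:Z = 1 + 1 by [].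
have back r i : cuts S r -> r i = r (i + 1) - (S (r (i + 1) - 1)).+1%:Z.
  case=> _ r0 rS; rewrite rS; case E: (S (r i + 1)).
    by rewrite two addrA addrK E two opprD addrA !addrK.
  by rewrite addrK r0 addrK.
move=> C C'; have [p0 _ pS] := C; have [p0' _ pS'] := C'.
elim/int_ind => [|n IH|n IH]; first by rewrite p0 p0'.
  by rewrite PoszS pS pS' IH.
by rewrite (back p) // (back p') // PoszS opprD subrK IH.
Qed.

(** The iterates of [f] and [g], which jump to the next and to the previous
unmarked point, enumerate the unmarked points from the origin. *)
Lemma cuts_exist (S : int -> bool) : S 0 = false ->
  (forall m, ~~ (S m && S (m + 1))) -> exists p, cuts S p.
Proof.
have two : true.+1%:Z = 1 + 1 by [].
move=> S0 SS; pose f m := m + (S (m + 1)).+1%:Z; pose g m := m - (S (m - 1)).+1%:Z.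
have Sf m : S m = false -> S (f m) = false.
  rewrite /f; case E: (S (m + 1)) => _ //.
  by have := SS (m + 1); rewrite E -addrA => /negbTE.
have Sg m : S m = false -> S (g m) = false.
  rewrite /g; case E: (S (m - 1)) => _ //.
  have := SS (m - 2%:Z); rewrite (_ : m - _ + 1 = m - 1) ?E ?andbT => [/negbTE//|].
  by rewrite two opprD addrA subrK.
have gK m : S m = false -> f (g m) = m.
  rewrite /f /g; case E: (S (m - 1)) => Sm.
    rewrite (_ : m - _ + 1 = m - 1) ?E ?subrK//.
    by rewrite two opprD addrA subrK.
  by rewrite subrK Sm subrK.
have Sig n : S (iter n g 0) = false by elim: n => //= n /Sg.
exists (fun i => match i with Posz n => iter n f 0 | Negz n => iter n.+1 g 0 end).
split=> // [[n|n]|[n|[|n]]]; rewrite ?Sig//.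
- by elim: n => //= n /Sf.
- by rewrite -PoszS.
- by rewrite (_ : _ + 1 = 0)// -[RHS]/(f (g 0)) gK.
rewrite (_ : Negz n.+1 + 1 = Negz n); last by rewrite NegzE PoszS opprD subrK.
by rewrite -[RHS]/(f (g (iter n.+1 g 0))) gK.
Qed.

(** The hypotheses on [z 0] say that a block starts at the origin. *)
Lemma desubstitution z : Omega_U z -> thin (z 0) = false -> flat (z 0) = false ->
  exists x, Omega_U x /\ conf_image omega x z.
Proof.
move=> Z z1 z2.
have [|p [p0 pN pS]] := @cuts_exist (fun i => thin (z (i, 0))) z1.
  move=> i; have /Omega_UP/(_ (i, 0))[/hmatch_no_thin_pair] := Z.
  by rewrite -[(i, 0) + e1]/(i + 1, 0 + 0) addr0.
have [|q [q0 qN qS]] := @cuts_exist (fun j => flat (z (0, j))) z2.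
  move=> j; have := no_flat_pair_column (0, j) Z.
  by rewrite -[(0, j) + e2]/(0 + 0, j + 1) addr0.
(* The cuts are read on the axes; they are valid in the whole plane because
   thinness is constant on columns and flatness on rows. *)
have /choice[x xP] (n : Z2) : exists a,
  [/\ width a = (thin (z (p n.1 + 1, 0))).+1, height a = (flat (z (0, q n.2 + 1))).+1 &
    forall s t, (s < width a)%N -> (t < height a)%N ->
      z (p n.1 + s%:Z, q n.2 + t%:Z) = letter a s t].
  have [||a [a1 a2 aE]] := @block_exists z (p n.1, q n.2) Z.
  - by rewrite thin_column //; exact: pN.
  - by rewrite flat_row //; exact: qN.
  exists a; rewrite /width /height a1 a2 !negbK in aE *.
  rewrite thin_column // flat_row // in aE *; split=> //.
have pS' n : p (n.1 + 1) = p n.1 + (width (x n))%:Z by have [-> _ _] := xP n.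
have qS' n : q (n.2 + 1) = q n.2 + (height (x n))%:Z by have [_ -> _] := xP n.
exists x; split; last first.
  by apply/omega_imageP; exists p, q; split=> // n; have [] := xP n.
apply/Omega_UP => -[i j]; have [w h zE] := xP (i, j); split.
  rewrite -[(i, j) + e1]/(i + 1, j + 0) addr0; have [w' h' zE'] := xP (i + 1, j).
  have hh : height (x (i, j)) = height (x (i + 1, j)) by rewrite h h'.
  rewrite hmatch_blocks; last by move: hh; rewrite /height; do 2!case: flat.
  apply/allP => t; rewrite mem_iota /= add0n => tj.
  rewrite -zE // -zE' // -?hh // addr0 (pS' (i, j)) /= /width.
  have /Omega_UP/(_ (p i + (~~ thin (x (i, j)))%:Z, q j + t%:Z))[+ _] := Z.
  by congr (hmatch _ (z (_, _))); rewrite /= ?addr0// -addrA -PoszS.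
rewrite -[(i, j) + e2]/(i + 0, j + 1) addr0; have [w' h' zE'] := xP (i, j + 1).
have ww : width (x (i, j)) = width (x (i, j + 1)) by rewrite w w'.
rewrite vmatch_blocks; last by move: ww; rewrite /width; do 2!case: thin.
apply/allP => s; rewrite mem_iota /= add0n => si.
rewrite -zE // -zE' // -?ww // addr0 (qS' (i, j)) /= /height.
have /Omega_UP/(_ (p i + s%:Z, q j + (~~ flat (x (i, j)))%:Z))[_] := Z.
by congr (vmatch _ (z (_, _))); rewrite /= ?addr0// -addrA -PoszS.
Qed.

(** * Recognizability and covering *)

(** The cutting of an image into blocks is dictated by its thin columns and its
flat rows. *)
Lemma image_cuts x z : conf_image omega x z ->
  exists p q, [/\ cuts (fun i => thin (z (i, 0))) p, cuts (fun j => flat (z (0, j))) q &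
    [/\ forall n, thin (x n) = ~~ thin (z (p n.1 + 1, 0)),
      forall n, flat (x n) = ~~ flat (z (0, q n.2 + 1)) &
      forall n s t, (s < width (x n))%N -> (t < height (x n))%N ->
        z (p n.1 + s%:Z, q n.2 + t%:Z) = letter (x n) s t]].
Proof.
move=> /omega_imageP[p [q [[p0 q0] pS qS zE]]].
have p1 i : thin (z (p i, 0)) = false.
  by have := zE (i, 0) 0%N 0%N isT isT; rewrite /= q0 !addr0 => ->; rewrite thin_letter.
have q1 j : flat (z (0, q j)) = false.
  by have := zE (0, j) 0%N 0%N isT isT; rewrite /= p0 !addr0 => ->; rewrite flat_letter.
have p2 n : thin (x n) = ~~ thin (z (p n.1 + 1, 0)).
  case xn : (thin (x n)).
    by have := pS n; rewrite /width xn => <-; rewrite p1.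
  have x0 : thin (x (n.1, 0)) = false.
    have := pS n; rewrite (pS (n.1, 0)) => /addPoszI; rewrite /width xn.
    by case: thin.
  have := zE (n.1, 0) 1%N 0%N; rewrite /width x0 => /(_ isT isT).
  by rewrite /= q0 addr0 => ->; rewrite thin_letter // /width x0.
have q2 n : flat (x n) = ~~ flat (z (0, q n.2 + 1)).
  case xn : (flat (x n)).
    by have := qS n; rewrite /height xn => <-; rewrite q1.
  have x0 : flat (x (0, n.2)) = false.
    have := qS n; rewrite (qS (0, n.2)) => /addPoszI; rewrite /height xn.
    by case: flat.
  have := zE (0, n.2) 0%N 1%N; rewrite /height x0 => /(_ isT isT).
  by rewrite /= p0 addr0 => ->; rewrite flat_letter // /height x0.
exists p, q; split=> //; split=> // i.
  by rewrite (pS (i, 0)) /width p2 negbK.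
by rewrite (qS (0, i)) /height q2 negbK.
Qed.

Lemma image_inj x x' z : conf_image omega x z -> conf_image omega x' z -> x = x'.
Proof.
move=> /image_cuts[p [q [pC qC [p1 q1 zE]]]] /image_cuts[p' [q' [pC' qC' [p1' q1' zE']]]].
apply/funext => n; have pE := cuts_uniq pC pC'; have qE := cuts_uniq qC qC'.
have tE : thin (x n) = thin (x' n) by rewrite p1 p1' pE.
have fE : flat (x n) = flat (x' n) by rewrite q1 q1' qE.
apply: letter_inj => // s t sn tn.
by rewrite -zE // pE qE zE' // /width /height -?tE -?fE.
Qed.

(** The coordinates of a centered [k] are 0 or 1, and [z k] is the letter of the
block at the origin in that column and row. *)
Lemma centered_offset x z k : conf_image omega x z -> centered omega k x ->
  k = ((thin (z k))%:Z, (flat (z k))%:Z).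
Proof.
move=> /omega_imageP[p [q [[p0 q0] _ _ zE]]].
rewrite /centered widthE heightE.
case: k => -[i|i] [j|j] [] //= i0 j0; have := zE 0 i j i0 j0.
rewrite /= p0 q0 !add0r => ->.
rewrite thin_letter // flat_letter //.
have b2 (b : bool) m : (m < b.+1)%N -> m = (m == 1%N) by case: b m => -[|[|]].
by congr (Posz _, Posz _); [exact: b2 i0 | exact: b2 j0].
Qed.

Lemma shiftK k (x : conf U) : shift (- k) (shift k x) = x.
Proof. by apply/funext => m; rewrite /shift subrK. Qed.

Lemma shiftNK k (x : conf U) : shift k (shift (- k) x) = x.
Proof. by apply/funext => m; rewrite /shift addrK. Qed.

Lemma omega_recognizable : recognizable omega Omega_U.
Proof.
move=> y [k x] [k' x'] /= [[_ [z [zI yE]]] xC] [[_ [z' [zI' yE']]] xC'].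
have kE := centered_offset zI xC; have kE' := centered_offset zI' xC'.
have z0 : z k = y 0 by rewrite yE /shift add0r.
have z0' : z' k' = y 0 by rewrite yE' /shift add0r.
have kk : k = k' by rewrite kE kE' z0 z0'.
subst k'; congr (_, _).
by apply: (image_inj zI); rewrite -(shiftK k z) -yE yE' shiftK.
Qed.

(** If the tile at the origin is thin, a block starts one column to the left, and
if it is flat, a block starts one row below. *)
Lemma Omega_shifted_images : Omega_U = image_set omega Omega_U
                `|` shift e1 @` image_set omega Omega_U
                `|` shift e2 @` image_set omega Omega_U
                `|` shift (e1 + e2) @` image_set omega Omega_U.
Proof.
have sub z : image_set omega Omega_U z -> Omega_U z.
  by move=> [x [X xz]]; exact: image_Omega xz.
apply/seteqP; split=> y; last first.
  by move=> [[[/sub//|]|]|] [z /sub Z <-]; exact: Omega_shift.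
move=> Y; pose k : Z2 := ((thin (y 0))%:Z, (flat (y 0))%:Z).
have kI : image_set omega Omega_U (shift (- k) y).
  have Z := Omega_shift (- k) Y; apply: desubstitution => //.
    have := thin_column Y (- k); rewrite /shift add0r => ->.
    rewrite /k /=; case y0 : (thin (y 0)); rewrite ?oppr0 ?y0 //.
    have /Omega_UP/(_ (-1, 0))[/hmatch_no_thin_pair + _] := Y.
    by rewrite (_ : (-1, 0) + e1 = 0) // y0 andbT => /negbTE.
  have := flat_row Y (- k); rewrite /shift add0r => ->.
  rewrite /k /=; case y0 : (flat (y 0)); rewrite ?oppr0 ?y0 //.
  have := no_flat_pair_column (0, -1) Y.
  by rewrite (_ : (0, -1) + e2 = 0) // y0 andbT => /negbTE.
rewrite -(shiftNK k y); move: kI; rewrite /k.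
case: thin; case: flat => kI.
- by right; exists (shift (- (1, 1)) y).
- by left; left; right; exists (shift (- (1, 0)) y).
- by left; right; exists (shift (- (0, 1)) y).
left; left; left; rewrite (_ : shift _ _ = shift (- (0, 0)) y) //.
by apply/funext => m; rewrite /shift addr0.
Qed.

Lemma omega_morphism : is_morphism2 omega Omega_U Omega_U.
Proof.
split=> x X; last first.
  have [y xy] := image_exists X; exists y; split=> //; exact: image_Omega xy.
move=> n; have /Omega_UP/(_ n)[/hmatch_flat f /vmatch_thin t] := X.
by rewrite /concatenable1 /concatenable2 !heightE !widthE /height /width f t.
Qed.

(** * Expansivity *)

(** Left ends of consecutive intervals of length one or two, the interval [i]
having length two when [b i] holds. *)
Definition partial_sums (b : nat -> bool) (n : nat) : nat := \sum_(i < n) (b i).+1.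

Lemma partial_sums_cover (b : nat -> bool) m : exists i s,
  (s <= b i)%N /\ m = (partial_sums b i + s)%N.
Proof.
elim: m => [|m [i [s [si ->]]]]; first by exists 0%N, 0%N; rewrite /partial_sums big_ord0.
have [si'|si'] := ltnP s (b i); first by exists i, s.+1; rewrite addnS.
exists i.+1, 0%N; rewrite addn0 /partial_sums big_ord_recr /= addnS.
by split=> //; do 2!f_equal; apply/eqP; rewrite eqn_leq si.
Qed.

Lemma partial_sums_ge (b : nat -> bool) n : (n <= partial_sums b n)%N.
Proof.
elim: n => // n IH; rewrite /partial_sums big_ord_recr /= -addn1.
by rewrite leq_add.
Qed.

Lemma partial_sums_gt (b : nat -> bool) n :
  b 0%N -> (0 < n)%N -> (n < partial_sums b n)%N.
Proof.
case: n => // n b0 _; rewrite /partial_sums big_ord_recl b0 add2n !ltnS.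
exact: (partial_sums_ge (fun i => b (bump 0 i))).
Qed.

Lemma partial_sums_le (b : nat -> bool) m n :
  (m <= n)%N -> (partial_sums b m <= partial_sums b n)%N.
Proof.
move=> /subnK <-; elim: (n - m)%N => // k IH.
by rewrite addSn /partial_sums big_ord_recr /= (leq_trans IH)// leq_addr.
Qed.

(** Finite words for which thinness depends on the column only and flatness on
the row only, so that they can be substituted.  The functions are defined on all
natural numbers, beyond the shape of the word, so that positions can be located
in blocks without side conditions. *)
Definition gridded (u : word2 U) (S T : nat -> bool) : Prop :=
  forall (i : 'I_(shape u).1) (j : 'I_(shape u).2),
    thin (u i j) = ~~ S i /\ flat (u i j) = ~~ T j.

(** The image is again gridded, since in each block the first column alone is not
thin; and [S' 0] and [T' 0] hold because it starts with a block.  This makes the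
next image strictly larger in both directions. *)
Lemma image_gridded u S T : gridded u S T -> exists v S' T',
  [/\ word_image omega u v, gridded v S' T', S' 0%N /\ T' 0%N &
      shape v = (partial_sums S (shape u).1, partial_sums T (shape u).2)].
Proof.
move=> uG; set p := partial_sums S; set q := partial_sums T.
have cover (b : nat -> bool) : exists c, forall m,
    ((c m).2 <= b (c m).1)%N /\ m = (partial_sums b (c m).1 + (c m).2)%N.
  have /choice[c cP] m : exists f : nat * nat,
      (f.2 <= b f.1)%N /\ m = (partial_sums b f.1 + f.2)%N.
    by have [i [s ?]] := partial_sums_cover b m; exists (i, s).
  by exists c.
have bound (b : nat -> bool) (c : nat -> nat * nat) n m :
    m = (partial_sums b (c m).1 + (c m).2)%N ->
    (m < partial_sums b n)%N -> ((c m).1 < n)%N.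
  move=> E; rewrite ltnNge [in X in _ -> X]ltnNge.
  apply: contra => /partial_sums_le -/(_ b) h.
  by rewrite E (leq_trans h)// leq_addr.
have [c cP] := cover S; have [d dP] := cover T.
have ci (k : 'I_(p (shape u).1)) : ((c k).1 < (shape u).1)%N.
  exact: bound (cP k).2 (ltn_ord k).
have dj (l : 'I_(q (shape u).2)) : ((d l).1 < (shape u).2)%N.
  exact: bound (dP l).2 (ltn_ord l).
pose v := @Word2 U (p (shape u).1, q (shape u).2) (fun k l =>
  letter (u (Ordinal (ci k)) (Ordinal (dj l))) (c k).2 (d l).2).
have wE i j : width (u i j) = (S i).+1 by rewrite /width (uG i j).1 negbK.
have hE i j : height (u i j) = (T j).+1 by rewrite /height (uG i j).2 negbK.
exists v, (fun k => (c k).2 == 0%N), (fun l => (d l).2 == 0%N); split=> //.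
- exists p, q; split.
  + by rewrite /p /q /partial_sums !big_ord0.
  + by move=> i j; rewrite widthE wE /p /partial_sums big_ord_recr.
  + by move=> i j; rewrite heightE hE /q /partial_sums big_ord_recr.
  + by [].
  move=> k l; exists (Ordinal (ci k)), (Ordinal (dj l)).
  have si : ((c k).2 < (shape (omega (u (Ordinal (ci k)) (Ordinal (dj l))))).1)%N.
    by rewrite widthE wE ltnS (cP k).1.
  have tj : ((d l).2 < (shape (omega (u (Ordinal (ci k)) (Ordinal (dj l))))).2)%N.
    by rewrite heightE hE ltnS (dP l).1.
  exists (Ordinal si), (Ordinal tj); rewrite letterE /=.
  by split; [exact: (cP k).2 | exact: (dP l).2 |].
- move=> k l; have [sk tl] := ((cP k).1, (dP l).1).
  have b01 (b : bool) m : (m <= b)%N -> (m == 1%N) = (m != 0%N) by case: b m => -[|[|]].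
  rewrite /= thin_letter ?flat_letter ?wE ?hE ?ltnS //.
  by rewrite (b01 _ _ sk) (b01 _ _ tl).
- have [_ /esym/eqP] := cP 0%N; have [_ /esym/eqP] := dP 0%N.
  by rewrite !addn_eq0 => /andP[_ ->] /andP[_ ->].
Qed.

Lemma omega_expansive : expansive omega.
Proof.
move=> a K; exists K.+1.
suff [w [S [T [wI _ _ wK]]]] : exists w S T, [/\ iter_image omega K.+1 (letter_word a) w,
    gridded w S T, S 0%N /\ T 0%N & (K < minn (shape w).1 (shape w).2)%N].
  by exists w.
elim: K => [|K [w [S [T [wI wG [S0 T0] wK]]]]].
  have [|v [S' [T' [av vG ST vE]]]] := @image_gridded (letter_word a)
    (fun=> ~~ thin a) (fun=> ~~ flat a); first by move=> i j; rewrite !negbK.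
  exists v, S', T'; split=> //; first by exists (letter_word a).
  by rewrite vE /= leq_min !partial_sums_ge.
have [v [S' [T' [wv vG ST vE]]]] := image_gridded wG.
exists v, S', T'; split=> //; first by exists w.
move: wK; rewrite !leq_min vE /= => /andP[w1 w2].
by rewrite (leq_ltn_trans w1) ?(leq_ltn_trans w2) ?partial_sums_gt //
   (leq_trans _ w1, leq_trans _ w2).
Qed.

Theorem proposition21 :
  [/\ is_morphism2 omega Omega_U Omega_U,
      expansive omega,
      recognizable omega Omega_U &
      Omega_U = image_set omega Omega_U
                `|` shift e1 @` image_set omega Omega_U
                `|` shift e2 @` image_set omega Omega_U
                `|` shift (e1 + e2) @` image_set omega Omega_U].
Proof.
split; [exact: omega_morphism | exact: omega_expansive
       | exact: omega_recognizable | exact: Omega_shifted_images].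
Qed.
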